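(* Let $\Phi(A)$ be an existential second order ($\Sigma_1^1$) formula whose only free variable is the second order relation variable $A$, and let $\vec v$ be a tuple of distinct first order variables whose length $|\vec v|$ equals the arity of $A$. Then there exists an inclusion/exclusion logic formula $\phi(\vec v)$, with free variables in $\vec v$, such that $$M \models_X \phi(\vec v) \Leftrightarrow M \models \Phi(\mathrm{Rel}_{\vec v}(X))$$ for all models $M$ of the signature of $\Phi$ and all nonempty teams $X$ over $M$ whose domain contains $\vec v$.
   Context: All first order models are assumed to have at least two elements in their domain; $\mathrm{Dom}(M)$ is the domain of $M$. An assignment over $M$ is a function from a set of variables to $\mathrm{Dom}(M)$; $s[m/x]$ is the assignment which sends $x$ to $m$ and otherwise agrees with $s$; $t\langle s\rangle$ is the value of the term $t$ in $M$ under $s$, and $\vec t\langle s\rangle$ is the corresponding tuple of values. A team $X$ over $M$ is a set of assignments over $M$ all having the same domain, called the domain of $X$. For a tuple of variables $\vec v = v_1\ldots v_k$ in the domain of $X$, $\mathrm{Rel}_{\vec v}(X) = \{(s(v_1),\ldots,s(v_k)) : s\in X\}$. Inclusion/exclusion (I/E) logic formulas are in negation normal form and are built from first order literals, inclusion atoms $\vec t_1 \subseteq \vec t_2$ and exclusion atoms $\vec t_1 ~|~ \vec t_2$ (with $\vec t_1,\vec t_2$ finite tuples of terms of the same length) using $\wedge,\vee,\exists x,\forall x$. The satisfaction relation $M\models_X\phi$ (lax team semantics), where the domain of $X$ contains the free variables of $\phi$, is: - for a first order literal $\phi$: $M\models_s\phi$ (Tarski) for all $s\in X$; - $M\models_X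 \vec t_1\subseteq\vec t_2$ iff for every $s\in X$ there is $s'\in X$ with $\vec t_1\langle s\rangle=\vec t_2\langle s'\rangle$; - $M\models_X \vec t_1~|~\vec t_2$ iff for all $s,s'\in X$, $\vec t_1\langle s\rangle\neq\vec t_2\langle s'\rangle$; - $M\models_X\psi\vee\theta$ iff $X=Y\cup Z$ for some teams $Y,Z$ with $M\models_Y\psi$ and $M\models_Z\theta$; - $M\models_X\psi\wedge\theta$ iff $M\models_X\psi$ and $M\models_X\theta$; - $M\models_X\exists x\psi$ iff there is $H:X\to\mathcal P(\mathrm{Dom}(M))\setminus\{\emptyset\}$ with $M\models_{X[H/x]}\psi$, where $X[H/x]=\{s[m/x]:s\in X,\ m\in H(s)\}$; - $M\models_X\forall x\psi$ iff $M\models_{X[M/x]}\psi$, where $X[M/x]=\{s[m/x]:s\in X,\ m\in\mathrm{Dom}(M)\}$. *)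

(* Defs.v *)
From mathcomp Require Import all_boot.
From mathcomp Require Import boolp classical_sets.

Set Implicit Arguments.
Unset Strict Implicit.
Unset Printing Implicit Defensive.

Local Open Scope classical_set_scope.

(* Throughout, an n-tuple over T is a function 'I_n -> T. *)

Definition var := nat.

(* Constants are the function symbols of arity 0. *)
Record signature := Signature {
  fsym : Type;
  far : fsym -> nat;
  rsym : Type;
  rar : rsym -> nat }.

Record model (S : signature) := Model {
  dom :> Type;
  two_elements : exists a b : dom, a <> b;
  finterp : forall f : fsym S, ('I_(far f) -> dom) -> dom;
  rinterp : forall r : rsym S, set ('I_(rar r) -> dom) }.

(* Assignments are partial functions: [s x = None] means that [x] is outside
   the domain of [s]. *)
Definition assignment (S : signature) (M : model S) := var -> option M.

Definition empty_assignment (S : signature) (M : model S) : assignment M :=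
  fun=> None.

Definition update (S : signature) (M : model S)
    (s : assignment M) (x : var) (m : M) : assignment M :=
  fun y => if y == x then Some m else s y.

Definition adom (S : signature) (M : model S) (s : assignment M) : set var :=
  [set x | isSome (s x)].

Inductive term (S : signature) : Type :=
| Var (x : var)
| App (f : fsym S) (args : 'I_(far f) -> term S).
Arguments Var {S} x.

Fixpoint term_fv (S : signature) (t : term S) : set var :=
  match t with
  | Var x => [set x]
  | App f args => [set x | exists i, term_fv (args i) x]
  end.

Definition default (S : signature) (M : model S) : M :=
  sval (cid (two_elements M)).

(* Total evaluation: [default M] is only returned for variables outside the
   domain of [s], which never occur when [term_fv t `<=` adom s]. *)
Fixpoint eval (S : signature) (M : model S) (s : assignment M) (t : term S) :
    M :=
  match t with
  | Var x => odflt (default M) (s x)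
  | App f args => @finterp S M f (fun i => eval s (args i))
  end.

Definition evals (S : signature) (M : model S) (s : assignment M) (n : nat)
    (ts : 'I_n -> term S) : 'I_n -> M :=
  fun i => eval s (ts i).

Inductive atom (S : signature) : Type :=
| Eq (t1 t2 : term S)
| Rel (r : rsym S) (args : 'I_(rar r) -> term S).

Definition atom_fv (S : signature) (a : atom S) : set var :=
  match a with
  | Eq t1 t2 => term_fv t1 `|` term_fv t2
  | Rel r args => [set x | exists i, term_fv (args i) x]
  end.

Definition atom_sat (S : signature) (M : model S) (s : assignment M)
    (a : atom S) : Prop :=
  match a with
  | Eq t1 t2 => eval s t1 = eval s t2
  | Rel r args => @rinterp S M r (evals s args)
  end.

Inductive fo (S : signature) : Type :=
| FOAtom (a : atom S)
| FONot (p : fo S)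
| FOAnd (p q : fo S)
| FOOr (p q : fo S)
| FOEx (x : var) (p : fo S)
| FOAll (x : var) (p : fo S).

Fixpoint fo_fv (S : signature) (p : fo S) : set var :=
  match p with
  | FOAtom a => atom_fv a
  | FONot p => fo_fv p
  | FOAnd p q | FOOr p q => fo_fv p `|` fo_fv q
  | FOEx x p | FOAll x p => fo_fv p `\ x
  end.

Fixpoint fo_sat (S : signature) (M : model S) (s : assignment M) (p : fo S) :
    Prop :=
  match p with
  | FOAtom a => atom_sat s a
  | FONot p => ~ fo_sat s p
  | FOAnd p q => fo_sat s p /\ fo_sat s q
  | FOOr p q => fo_sat s p \/ fo_sat s q
  | FOEx x p => exists m : M, fo_sat (update s x m) p
  | FOAll x p => forall m : M, fo_sat (update s x m) p
  end.

(* A second order variable is a fresh symbol: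
   a formula over S in which one n-ary relation (function) variable is
   available is a formula over [add_rel S n] ([add_fun S n]), the variable
   being the symbol [None]. *)

Definition add_rel (S : signature) (n : nat) : signature :=
  @Signature (fsym S) (@far S) (option (rsym S))
    (fun o => if o is Some r then rar r else n).

Definition add_fun (S : signature) (n : nat) : signature :=
  @Signature (option (fsym S)) (fun o => if o is Some f then far f else n)
    (rsym S) (@rar S).

Definition expand_rel (S : signature) (n : nat) (M : model S)
    (R : set ('I_n -> M)) : model (add_rel S n) :=
  @Model (add_rel S n) (dom M) (two_elements M) (@finterp S M)
    (fun o => match o return set ('I_(@rar (add_rel S n) o) -> M) with
              | Some r => @rinterp S M r
              | None => R
              end).

Definition expand_fun (S : signature) (n : nat) (M : model S)
    (F : ('I_n -> M) -> M) : model (add_fun S n) :=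
  @Model (add_fun S n) (dom M) (two_elements M)
    (fun o => match o return ('I_(@far (add_fun S n) o) -> M) -> M with
              | Some f => @finterp S M f
              | None => F
              end)
    (@rinterp S M).

Inductive eso (S : signature) : Type :=
| ESOMatrix (p : fo S)
| ESOExRel (n : nat) (P : eso (add_rel S n))
| ESOExFun (n : nat) (P : eso (add_fun S n)).

Fixpoint eso_fv (S : signature) (P : eso S) : set var :=
  match P with
  | ESOMatrix p => fo_fv p
  | ESOExRel n P => eso_fv P
  | ESOExFun n P => eso_fv P
  end.

(* The empty assignment is harmless when [eso_fv P = set0]. *)
Fixpoint eso_sat (S : signature) (P : eso S) : model S -> Prop :=
  match P with
  | ESOMatrix p => fun M => fo_sat (empty_assignment M) p
  | ESOExRel n P => fun M =>
      exists R : set ('I_n -> M), eso_sat P (expand_rel R)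
  | ESOExFun n P => fun M =>
      exists F : ('I_n -> M) -> M, eso_sat P (expand_fun F)
  end.

Inductive ie (S : signature) : Type :=
| IEPos (a : atom S)
| IENeg (a : atom S)
| IEInc (n : nat) (t1 t2 : 'I_n -> term S)
| IEExc (n : nat) (t1 t2 : 'I_n -> term S)
| IEAnd (p q : ie S)
| IEOr (p q : ie S)
| IEEx (x : var) (p : ie S)
| IEAll (x : var) (p : ie S).

Fixpoint ie_fv (S : signature) (p : ie S) : set var :=
  match p with
  | IEPos a | IENeg a => atom_fv a
  | IEInc n t1 t2 | IEExc n t1 t2 =>
      [set x | exists i, term_fv (t1 i) x \/ term_fv (t2 i) x]
  | IEAnd p q | IEOr p q => ie_fv p `|` ie_fv q
  | IEEx x p | IEAll x p => ie_fv p `\ x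
  end.

Definition is_team (S : signature) (M : model S) (V : set var)
    (X : set (assignment M)) : Prop :=
  forall s, X s -> adom s = V.

Definition supplement (S : signature) (M : model S) (X : set (assignment M))
    (x : var) (H : assignment M -> set M) : set (assignment M) :=
  [set s' | exists s m, [/\ X s, H s m & s' = update s x m]].

Definition duplicate (S : signature) (M : model S) (X : set (assignment M))
    (x : var) : set (assignment M) :=
  [set s' | exists s m, X s /\ s' = update s x m].

(* In the disjunction, Y and Z have the domain of X, being subsets of X. In
   the existential case, only the values of H on X matter. *)
Fixpoint ie_sat (S : signature) (M : model S) (X : set (assignment M))
    (p : ie S) : Prop :=
  match p with
  | IEPos a => forall s, X s -> atom_sat s a
  | IENeg a => forall s, X s -> ~ atom_sat s a
  | IEInc n t1 t2 =>
      forall s, X s -> exists2 s', X s' & evals s t1 = evals s' t2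
  | IEExc n t1 t2 =>
      forall s s', X s -> X s' -> evals s t1 <> evals s' t2
  | IEAnd p q => ie_sat X p /\ ie_sat X q
  | IEOr p q =>
      exists Y Z : set (assignment M),
        [/\ X = Y `|` Z, ie_sat Y p & ie_sat Z q]
  | IEEx x p =>
      exists H : assignment M -> set M,
        (forall s, X s -> H s !=set0) /\ ie_sat (supplement X x H) p
  | IEAll x p => ie_sat (duplicate X x) p
  end.

(* Meaningful when the domain of X contains the range of v. *)
Definition team_rel (S : signature) (M : model S) (k : nat) (v : 'I_k -> var)
    (X : set (assignment M)) : set ('I_k -> M) :=
  [set r | exists2 s, X s & forall i, s (v i) = Some (r i)].

(* Main.v *)
(* A function F : M^n -> M^m is coded in a team by variables z ranging over all of
   M^n and variables w with the functional dependence z -> w, which an exclusion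
   atom can express; the value of F at x is then looked up by the inclusion atom
   xy <= zw, where the fresh y is existentially quantified. Relations are coded by
   two functions which agree exactly on the relation. All further quantifiers leave
   the set of rows zw unchanged, so lookups stay correct and the first order matrix
   translates to a flat formula, provided team disjunction is only applied to
   literals: truth values of subformulas are stored as pairs of variables (equal =
   true). Finally the variable A is coded the same way and tied to the team by
   inclusions in both directions between A and the values of v; the inclusion of A
   in Rel_v(X) needs a dummy value where A fails, whence X nonempty. *)

Require Import Defs.
From mathcomp Require Import all_boot zify.
From mathcomp Require Import boolp classical_sets.

Set Implicit Arguments.
Unset Strict Implicit.
Unset Printing Implicit Defensive.

Local Open Scope classical_set_scope.

(** * Blocks of quantifiers *)

Section Blocks.
Variables (S : signature) (M : model S).
Implicit Types (s : assignment M) (X Y : set (assignment M)) (p : ie S).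

Definition val s (x : var) : M := odflt (default M) (s x).

(** [a] is indexed by the variables themselves rather than by offsets in the block, so that peeling
    off the first variable leaves [a] unchanged. *)
Definition set_block s N n (a : var -> M) : assignment M :=
  fun x => if N <= x < N + n then Some (a x) else s x.

Lemma set_block0 s N a : set_block s N 0 a = s.
Proof. by apply: funext => x; rewrite /set_block; case: ifP => //; lia. Qed.

Lemma set_blockS s N n a :
  set_block (update s N (a N)) N.+1 n a = set_block s N n.+1 a.
Proof.
apply: funext => x; rewrite /set_block /update.
case: (ltngtP N x) => [lt_Nx|lt_xN|<-] /=.
- by rewrite addSnnS.
- by [].
- by rewrite addnS ltnS leq_addr.
Qed.

Lemma eq_set_block s N n a b :
  (forall x, N <= x < N + n -> a x = b x) -> set_block s N n a = set_block s N n b.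
Proof.
by move=> eqab; apply: funext => x; rewrite /set_block; case: ifP => // /eqab ->.
Qed.

Lemma val_set_block_out s N n a x : x < N -> val (set_block s N n a) x = val s x.
Proof. by move=> ltx; rewrite /val /set_block leqNgt ltx. Qed.

Lemma val_set_block_in s N n a i :
  i < n -> val (set_block s N n a) (N + i) = a (N + i).
Proof. by move=> ltin; rewrite /val /set_block leq_addr ltn_add2l ltin. Qed.

Definition of_ord N n (g : 'I_n -> M) : var -> M :=
  fun x => if insub (x - N) is Some i then g i else default M.

Lemma of_ordE N n (g : 'I_n -> M) (i : 'I_n) : of_ord N g (N + i) = g i.
Proof. by rewrite /of_ord addKn valK. Qed.

(** Under lax semantics a row may receive several values at once, so no functional condition
    appears: this is reachability of [Y] from [X] by a block of existential quantifiers. *)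
Definition block_ext N n X Y :=
  (forall s, X s -> exists a, Y (set_block s N n a)) /\
  (forall s', Y s' -> exists s a, X s /\ s' = set_block s N n a).

Fixpoint ex_block N n p := if n is n'.+1 then IEEx N (ex_block N.+1 n' p) else p.

Fixpoint all_block N n p :=
  if n is n'.+1 then IEAll N (all_block N.+1 n' p) else p.

Lemma sat_ex_block N n X p :
  ie_sat X (ex_block N n p) <-> exists Y, block_ext N n X Y /\ ie_sat Y p.
Proof.
elim: n N X => [|n IHn] N X /=.
  split=> [Xp|[Y [[XY YX] Yp]]].
    exists X; split=> //; split=> s Xs.
      by exists (fun=> default M); rewrite set_block0.
    by exists s, (fun=> default M); rewrite set_block0.
  suff -> : X = Y by [].
  apply/seteqP; split=> s.
    by move=> /XY[a]; rewrite set_block0.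
  by move=> /YX[s0 [a [Xs ->]]]; rewrite set_block0.
split=> [[H [H0 /IHn[Y [[XY YX] Yp]]]]|[Y [[XY YX] Yp]]].
  exists Y; split=> //; split=> s.
    move=> Xs; have [m Hm] := H0 _ Xs.
    have [a Ya] : exists a, Y (set_block (update s N m) N.+1 n a).
      by apply: XY; exists s, m.
    (* The first quantifier supplies the value at [N], the inner block the remaining ones. *)
    exists (fun x => if x == N then m else a x).
    rewrite -set_blockS eqxx.
    by rewrite (@eq_set_block _ _ _ _ a) // => x; case: eqP => //; lia.
  move=> /YX[_ [a [[s0 [m [Xs Hm ->]] ->]]]].
  exists s0, (fun x => if x == N then m else a x); split=> //.
  rewrite -set_blockS eqxx.
  by apply: eq_set_block => x; case: eqP => //; lia.
(* The values offered for the first variable are those taken there by the rows of [Y] that extend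
   [s]. *)
exists (fun s => [set m | exists a, a N = m /\ Y (set_block s N n.+1 a)]).
split=> [s /XY[a Ya]|]; first by exists (a N), a.
apply/IHn; exists Y; split=> //; split=> s.
  move=> [s0 [_ [Xs [a [<- Ya]] ->]]]; exists a.
  by rewrite set_blockS.
move=> Ys; have [s0 [a [Xs es]]] := YX _ Ys.
exists (update s0 N (a N)), a; rewrite set_blockS; split=> //.
by exists s0, (a N); split=> //; exists a; rewrite -es.
Qed.

Definition dup_block N n X := [set s' | exists s a, X s /\ s' = set_block s N n a].

Lemma sat_all_block N n X p :
  ie_sat X (all_block N n p) <-> ie_sat (dup_block N n X) p.
Proof.
elim: n N X => [|n IHn] N X /=.
  suff -> : dup_block N 0 X = X by [].
  apply/seteqP; split=> [_ [s [a [Xs ->]]]|s Xs]; first by rewrite set_block0.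
  by exists s, (fun=> default M); rewrite set_block0.
rewrite IHn; suff -> : dup_block N.+1 n (duplicate X N) = dup_block N n.+1 X by [].
apply/seteqP; split=> [_ [_ [a [[s [m [Xs ->]]] ->]]]|_ [s [a [Xs ->]]]].
  exists s, (fun x => if x == N then m else a x); split=> //.
  rewrite -set_blockS eqxx.
  by apply: eq_set_block => x; case: eqP => //; lia.
exists (update s N (a N)), a; rewrite set_blockS; split=> //.
by exists s, (a N).
Qed.

(** * Teams agreeing on the variables below a bound *)

Definition agree N s s' := forall x, x < N -> s x = s' x.

(** Equality of the restrictions of two teams to the variables below [N], the invariant kept while
    variables from [N] on are requantified. *)
Definition team_ext N X Y :=
  (forall s, X s -> exists2 s', Y s' & agree N s s') /\
  (forall s', Y s' -> exists2 s, X s & agree N s s').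

Lemma agree_set_block s N n a : agree N s (set_block s N n a).
Proof. by move=> x ltx; rewrite /set_block leqNgt ltx. Qed.

Lemma agree_val N s s' x : agree N s s' -> x < N -> val s x = val s' x.
Proof. by rewrite /val => ss' ltx; rewrite ss'. Qed.

Lemma team_ext_refl N X : team_ext N X X.
Proof. by split=> s Xs; exists s. Qed.

Lemma team_ext_trans N X Y Z : team_ext N X Y -> team_ext N Y Z -> team_ext N X Z.
Proof.
move=> [XY YX] [YZ ZY]; split=> s.
  move=> /XY[s1 /YZ[s2 Zs2 s12] s01]; exists s2 => // x ltx.
  by rewrite s01 // s12.
move=> /ZY[s1 /YX[s2 Xs2 s21] s10]; exists s2 => // x ltx.
by rewrite s21 // s10.
Qed.

Lemma team_ext_leq N K X Y : N <= K -> team_ext K X Y -> team_ext N X Y.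
Proof.
move=> leNK [XY YX]; split=> s.
  by move=> /XY[s' Ys' ss']; exists s' => // x ltx; apply: ss'; lia.
by move=> /YX[s' Ys' ss']; exists s' => // x ltx; apply: ss'; lia.
Qed.

Lemma team_ext_nonempty N X Y : team_ext N X Y -> X !=set0 -> Y !=set0.
Proof. by move=> [XY _] [s /XY[s' Ys' _]]; exists s'. Qed.

Lemma block_team_ext N n X Y : block_ext N n X Y -> team_ext N X Y.
Proof.
move=> [XY YX]; split=> s.
  by move=> /XY[a Ya]; exists (set_block s N n a) => //; exact: agree_set_block.
by move=> /YX[s0 [a [Xs ->]]]; exists s0 => //; exact: agree_set_block.
Qed.

Lemma dup_block_ext N n X : block_ext N n X (dup_block N n X).
Proof.
split=> // s Xs; exists (fun=> default M).
by exists s, (fun=> default M).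
Qed.

(** Coding falsity takes two distinct elements, hence the standing assumption on domains. *)
Lemma flag_exists (P : Prop) : exists m1 m2 : M, (m1 = m2) = P.
Proof.
have [a [b ab]] := two_elements M.
have [p|np] := pselect P; [exists a, a | exists a, b]; exact: propext.
Qed.

End Blocks.

(** * Formulas of inclusion/exclusion logic defining flat properties *)

(** The unit is an equation between variables, as the signature may lack constants; a free variable
    0 introduced this way is quantified away by [close_formula] unless it belongs to [v]. *)
Definition bigand S n (p : 'I_n -> ie S) : ie S :=
  foldr (fun i q => IEAnd (p i) q) (IEPos (Eq (Var 0) (Var 0))) (enum 'I_n).

Lemma sat_bigand S (M : model S) (X : set (assignment M)) n (p : 'I_n -> ie S) :
  ie_sat X (bigand p) <-> forall i, ie_sat X (p i).
Proof.
transitivity (forall i, i \in enum 'I_n -> ie_sat X (p i)); last first.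
  by split=> H i *; apply: H; rewrite mem_enum.
rewrite /bigand; elim: (enum 'I_n) => [//|i r IHr] /=; rewrite IHr.
split=> [[pi pr] j|H]; first by rewrite inE => /orP[/eqP->|/pr].
by split=> [|j jr]; apply: H; rewrite inE ?eqxx ?jr ?orbT.
Qed.

Section Literals.
Variable S : signature.
Implicit Types P Q : forall M : model S, assignment M -> Prop.

Definition literal P :=
  exists p : ie S, forall (M : model S) (X : set (assignment M)),
    ie_sat X p <-> forall s, X s -> P M s.

(** Formulas are in negation normal form, so closure under Boolean connectives is obtained by
    carrying a formula for the complement along. *)
Definition decidable_literal P := literal P /\ literal (fun M s => ~ P M s).

Lemma eq_literal P Q :
  (forall M s, P M s <-> Q M s) -> literal P -> literal Q.
Proof.
move=> PQ [p pP]; exists p => M X; rewrite pP.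
by split=> H s /H /PQ.
Qed.

Lemma literal_and P Q : literal P -> literal Q -> literal (fun M s => P M s /\ Q M s).
Proof.
move=> [p pP] [q qQ]; exists (IEAnd p q) => M X /=; rewrite pP qQ.
split=> [[Xp Xq] s Xs|H]; first by split; [exact: Xp | exact: Xq].
by split=> s /H[].
Qed.

Lemma literal_or P Q : literal P -> literal Q -> literal (fun M s => P M s \/ Q M s).
Proof.
move=> [p pP] [q qQ]; exists (IEOr p q) => M X /=; split.
  by move=> [Y [Z [-> /pP Yp /qQ Zq]]] s [/Yp|/Zq]; [left | right].
(* Flatness allows splitting the team row by row, according to which disjunct holds. *)
move=> H; exists [set s | X s /\ P M s], [set s | X s /\ Q M s]; split.
- apply/seteqP; split=> s; last by case=> -[].
  by move=> Xs; case: (H s Xs) => ?; [left | right].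
- by rewrite pP => s [].
- by rewrite qQ => s [].
Qed.

Lemma decidable_not P : decidable_literal P -> decidable_literal (fun M s => ~ P M s).
Proof.
move=> [p np]; split=> //; apply: eq_literal p => M s.
by split=> [Ps nPs|/contrapT].
Qed.

Lemma decidable_or P Q :
  decidable_literal P -> decidable_literal Q ->
  decidable_literal (fun M s => P M s \/ Q M s).
Proof.
move=> [p np] [q nq]; split; first exact: literal_or.
by apply: eq_literal (literal_and np nq) => M s; rewrite not_orE.
Qed.

Lemma eq_decidable P Q :
  (forall M s, P M s <-> Q M s) -> decidable_literal P -> decidable_literal Q.
Proof.
move=> PQ [p np]; split; first exact: eq_literal p.
by apply: eq_literal np => M s; rewrite PQ.
Qed.

Lemma decidable_and P Q :
  decidable_literal P -> decidable_literal Q ->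
  decidable_literal (fun M s => P M s /\ Q M s).
Proof.
move=> [p np] [q nq]; split; first exact: literal_and.
by apply: eq_literal (literal_or np nq) => M s; rewrite not_andE.
Qed.

Lemma decidable_imply P Q :
  decidable_literal P -> decidable_literal Q ->
  decidable_literal (fun M s => P M s -> Q M s).
Proof.
move=> p q; apply: eq_decidable (decidable_or (decidable_not p) q) => M s.
by rewrite implyE.
Qed.

Lemma decidable_iff P Q :
  decidable_literal P -> decidable_literal Q ->
  decidable_literal (fun M s => P M s <-> Q M s).
Proof.
by move=> p q; apply: decidable_and; apply: decidable_imply.
Qed.

Lemma decidable_atom (a : atom S) : decidable_literal (fun M s => atom_sat s a).
Proof. by split; [exists (IEPos a) | exists (IENeg a)]. Qed.

Lemma decidable_eq x y : decidable_literal (fun M s => val s x = val s y).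
Proof. exact: (decidable_atom (Eq (Var x) (Var y))). Qed.

End Literals.

(* [graph r a m1 m2] holds of the admissible codings [(m1, m2)] of the truth value
   of [r] at [a]: truth is coded by a pair of equal elements. It is a relation
   because for the symbols of [S] all codings are admissible, whereas a table
   provides a single one. *)
Record env (S S' : signature) (M : model S) := Env {
  fun_of : forall f : Defs.fsym S', ('I_(far f) -> M) -> M;
  rel_of : forall r : rsym S', set ('I_(rar r) -> M);
  graph : forall r : rsym S', ('I_(rar r) -> M) -> M -> M -> Prop;
  graph_total : forall r a, exists m1 m2, @graph r a m1 m2;
  graph_sound : forall r a m1 m2, @graph r a m1 m2 -> (m1 = m2) = @rel_of r a }.

Definition env_model S S' (M : model S) (e : env S' M) : model S' :=
  Model (two_elements M) (@fun_of _ _ _ e) (@rel_of _ _ _ e).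

(** Lookups apply to variables only: compound terms are first evaluated into fresh variables. *)
Record access (S S' : signature) := Access {
  acc_fun : forall f : Defs.fsym S', ('I_(far f) -> var) -> var -> ie S;
  acc_rel : forall r : rsym S', ('I_(rar r) -> var) -> var -> var -> ie S }.

Definition vals S (M : model S) (s : assignment M) n (x : 'I_n -> var) : 'I_n -> M :=
  fun i => val s (x i).

Definition realizes S S' (A : access S S') (M : model S) (e : env S' M)
    (X : set (assignment M)) : Prop :=
  (forall f x c, ie_sat X (@acc_fun _ _ A f x c) <->
     forall s, X s -> fun_of e (vals s x) = val s c) /\
  (forall r x c d, ie_sat X (@acc_rel _ _ A r x c d) <->
     forall s, X s -> graph e (vals s x) (val s c) (val s d)).

(* Quantifying over extensions of [X] makes this property stable under
   requantification of the variables [>= N]. *)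
Definition good S S' (A : access S S') N (M : model S) (e : env S' M)
    (X : set (assignment M)) : Prop :=
  forall Y, team_ext N X Y -> realizes A e Y.

Lemma good_ext S S' (A : access S S') N K (M : model S) (e : env S' M)
    (X Y : set (assignment M)) :
  N <= K -> team_ext K X Y -> good A N e X -> good A K e Y.
Proof.
move=> leNK XY gX Z YZ; apply: gX.
exact/(team_ext_leq leNK)/(team_ext_trans XY).
Qed.

(** * Translation of first order formulas over teams carrying tables *)

Section Expressible.
Variables (S S' : signature) (A : access S S') (N0 : nat).
Implicit Types P Q : forall M : model S, env S' M -> assignment M -> Prop.

Definition expressible P :=
  exists p : ie S, forall (M : model S) (e : env S' M) (X : set (assignment M)),
    good A N0 e X -> (ie_sat X p <-> forall s, X s -> P M e s).

Lemma eq_expressible P Q :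
  (forall M e s, P M e s <-> Q M e s) -> expressible P -> expressible Q.
Proof.
move=> PQ [p pP]; exists p => M e X gX; rewrite (pP M e X gX).
by split=> H s /H /PQ.
Qed.

Lemma expressible_literal (P : forall M : model S, assignment M -> Prop) :
  literal P -> expressible (fun M e s => P M s).
Proof. by move=> [p pP]; exists p => M e X _. Qed.

Lemma expressible_and P Q :
  expressible P -> expressible Q -> expressible (fun M e s => P M e s /\ Q M e s).
Proof.
move=> [p pP] [q qQ]; exists (IEAnd p q) => M e X gX /=; rewrite (pP M e X gX) (qQ M e X gX).
split=> [[Xp Xq] s Xs|H]; first by split; [exact: Xp | exact: Xq].
by split=> s /H[].
Qed.

Lemma expressible_forall n (P : 'I_n -> forall M, env S' M -> assignment M -> Prop) :
  (forall i, expressible (P i)) -> expressible (fun M e s => forall i, P i M e s).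
Proof.
move=> /choice[p pP]; exists (bigand p) => M e X gX; rewrite sat_bigand.
split=> [H s Xs i|H i]; first by move: s Xs; exact/(pP i M e X gX)/H.
by apply/(pP i M e X gX) => s Xs; exact: H.
Qed.

Lemma expressible_ex_block N n P :
  N0 <= N -> expressible P ->
  expressible (fun M e s => exists a, P M e (set_block s N n a)).
Proof.
move=> leN0N [p pP]; exists (ex_block N n p) => M e X gX; rewrite sat_ex_block.
have gY Y : block_ext N n X Y -> good A N0 e Y.
  by move=> /block_team_ext /(team_ext_leq leN0N) XY; exact: good_ext gX.
split=> [[Y [XY /(pP _ _ _ (gY _ XY)) Yp]] s|H].
  by case: XY => [XY _] /XY[a Ya]; exists a; exact: Yp.
(* The largest team of extended rows satisfying [P]; laxness permits keeping all of them. *)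
pose Y := [set s' | exists s a, [/\ X s, s' = set_block s N n a & P M e s']].
have XY : block_ext N n X Y.
  split=> [s Xs|_ [s [a [Xs -> _]]]]; last by exists s, a.
  by have [a Pa] := H s Xs; exists a, s, a.
exists Y; split=> //; apply/(pP _ _ _ (gY _ XY)).
by move=> s' [s [a [_ _]]].
Qed.

Lemma expressible_all_block N n P :
  N0 <= N -> expressible P ->
  expressible (fun M e s => forall a, P M e (set_block s N n a)).
Proof.
move=> leN0N [p pP]; exists (all_block N n p) => M e X gX; rewrite sat_all_block.
have gdX : good A N0 e (dup_block N n X).
  by apply: good_ext gX => //; exact/(team_ext_leq leN0N)/block_team_ext/dup_block_ext.
rewrite (pP _ _ _ gdX).
split=> [H s Xs a|H _ [s [a [Xs ->]]]]; last exact: H.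
by apply: H; exists s, a.
Qed.

Lemma expressible_fun f x c :
  expressible (fun M e s => @fun_of _ _ _ e f (vals s x) = val s c).
Proof.
by exists (acc_fun A x c) => M e X /(_ _ (team_ext_refl _ _))[].
Qed.

Lemma expressible_rel r x c d :
  expressible (fun M e s => @graph _ _ _ e r (vals s x) (val s c) (val s d)).
Proof.
by exists (acc_rel A x c d) => M e X /(_ _ (team_ext_refl _ _))[].
Qed.

(** [rho] sends the variables of a formula over [S'] to team variables, so that each quantifier can
    bind a fresh team variable and leave the tables intact. *)
Definition pull (M : model S) (e : env S' M) (s : assignment M) (rho : var -> var) :
    assignment (env_model e) :=
  fun x => Some (val s (rho x)).

Lemma pull_set_block M (e : env S' M) s N n a rho :
  (forall x, rho x < N) -> pull e (set_block s N n a) rho = pull e s rho.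
Proof. by move=> ltrho; apply: funext => x; rewrite /pull val_set_block_out. Qed.

(** The values of the arguments are guessed in a fresh block, after which the outermost symbol is
    looked up at variables. *)
Lemma expressible_term (t : term S') N rho c :
  N0 <= N -> (forall x, rho x < N) -> c < N ->
  expressible (fun M e s => val s c = eval (pull e s rho) t).
Proof.
elim: t N rho c => [x|f args IHargs] N rho c leN0N ltrho ltc.
  by apply: (@expressible_literal (fun M s => val s c = val s (rho x))); case: (decidable_eq S c (rho x)).
pose n := far f.
have Ei i := IHargs i (N + n) rho (N + i).
have Eargs : expressible (fun M e s =>
    forall i : 'I_n, val s (N + i) = eval (pull e s rho) (args i)).
  apply: expressible_forall => i; apply: Ei; rewrite ?ltn_add2l //; first lia.
  by move=> x; have := ltrho x; lia.
have := expressible_ex_block n leN0N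
  (expressible_and Eargs (@expressible_fun f (fun i => N + i) c)).
apply: eq_expressible => M e s /=; split.
  move=> [a [Ha]]; rewrite val_set_block_out // => <-; congr fun_of; apply: funext => i.
  by rewrite /vals Ha pull_set_block.
move=> Ec; exists (of_ord N (fun i => eval (pull e s rho) (args i))).
rewrite pull_set_block // val_set_block_out // Ec.
have Ha (i : 'I_n) :
    val (set_block s N n (of_ord N (fun i => eval (pull e s rho) (args i)))) (N + i) = eval (pull e s rho) (args i).
  by rewrite val_set_block_in // of_ordE.
split=> //; congr fun_of; apply: funext => i; exact: Ha.
Qed.

(* Since the disjunction of team semantics would destroy the tables, the truth
   values of [q] and [r] are guessed as pairs of flags, and only literals about
   flags are ever split. *)
Lemma expressible_connective (B : Prop -> Prop -> Prop -> Prop) N rho c1 c2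
    (q r : fo S') :
  (forall c1 c2 d1 d2 e1 e2, decidable_literal (fun (M : model S) s =>
     B (val s c1 = val s c2) (val s d1 = val s d2) (val s e1 = val s e2))) ->
  N0 <= N -> (forall x, rho x < N) -> c1 < N -> c2 < N ->
  (forall K d1 d2, N <= K -> d1 < K -> d2 < K -> expressible (fun M e s =>
     (val s d1 = val s d2) <-> fo_sat (pull e s rho) q)) ->
  (forall K d1 d2, N <= K -> d1 < K -> d2 < K -> expressible (fun M e s =>
     (val s d1 = val s d2) <-> fo_sat (pull e s rho) r)) ->
  expressible (fun M e s =>
    B (val s c1 = val s c2) (fo_sat (pull e s rho) q) (fo_sat (pull e s rho) r)).
Proof.
move=> decB leN0N ltrho ltc1 ltc2 Eq Er.
(* The flags of [q] occupy [N] and [N + 1], those of [r] occupy [N + 2] and [N + 3]. The form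
   [N + 0] is the one that [val_set_block_in] matches. *)
have {}Eq := Eq (N + 4) (N + 0) (N + 1).
have {}Er := Er (N + 4) (N + 2) (N + 3).
have [litB _] := decB c1 c2 (N + 0) (N + 1) (N + 2) (N + 3).
have := expressible_ex_block 4 leN0N (expressible_and
  (expressible_and (Eq _ _ _) (Er _ _ _)) (expressible_literal litB)).
move=> /(_ ltac:(lia) ltac:(lia) ltac:(lia) ltac:(lia) ltac:(lia) ltac:(lia)).
apply: eq_expressible => M e s /=; split.
  move=> [a]; rewrite pull_set_block //
    (@val_set_block_out _ _ _ _ 4 _ _ ltc1)
    (@val_set_block_out _ _ _ _ 4 _ _ ltc2).
  by move=> [[/propext-> /propext->]].
move=> HB.
have [m1 [m2 m12]] := flag_exists M (fo_sat (pull e s rho) q).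
have [m3 [m4 m34]] := flag_exists M (fo_sat (pull e s rho) r).
exists (fun x => nth m1 [:: m1; m2; m3; m4] (x - N)).
rewrite pull_set_block //
  (@val_set_block_out _ _ _ _ 4 _ _ ltc1)
  (@val_set_block_out _ _ _ _ 4 _ _ ltc2).
by rewrite !val_set_block_in // !addKn /= m12 m34.
Qed.

Lemma pull_quantified M (e : env S' M) s N a rho x :
  (forall y, rho y < N) ->
  pull e (set_block s N 1 a) (fun y => if y == x then N else rho y) =
  update (pull e s rho) x (a N : env_model e).
Proof.
move=> ltrho; apply: funext => y; rewrite /pull /update; case: eqP => _.
  by rewrite -{2 3}[N]addn0 val_set_block_in.
by rewrite val_set_block_out.
Qed.

(** Equivalence of a flag with a quantified formula amounts to one universal and one existential
    statement, each about an implication between flag and body. The cases [FOEx] and [FOAll] use the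
    two implications in opposite roles. *)
Lemma expressible_under_quantifier x (q : fo S') N rho c1 c2 :
  (forall K rho d1 d2, N0 <= K -> (forall y, rho y < K) -> d1 < K -> d2 < K ->
    expressible (fun M e s => (val s d1 = val s d2) <-> fo_sat (pull e s rho) q)) ->
  N0 <= N -> (forall y, rho y < N) -> c1 < N -> c2 < N ->
  let rho' y := if y == x then N else rho y in
  expressible (fun M e s => fo_sat (pull e s rho') q -> val s c1 = val s c2) /\
  expressible (fun M e s => val s c1 = val s c2 -> fo_sat (pull e s rho') q).
Proof.
move=> IHq leN0N ltrho ltc1 ltc2 rho'.
have ltrho' y : rho' y < N + 1 by rewrite /rho'; have := ltrho y; case: ifP => _; lia.
have leN0N1 : N0 <= N + 1 by lia.
have [ltc1' ltc2'] : c1 < N + 1 /\ c2 < N + 1 by split; lia.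
have IH K d1 d2 : N + 1 <= K -> d1 < K -> d2 < K -> expressible (fun M e s =>
    val s d1 = val s d2 <-> fo_sat (pull e s rho') q).
  by move=> leNK; apply: (IHq K) => [|y]; [lia | have := ltrho' y; lia].
split.
- apply: (@expressible_connective (fun p q _ => q -> p) _ _ _ _ _ _ _
    leN0N1 ltrho' ltc1' ltc2' IH IH) => *.
  by apply: decidable_imply; exact: decidable_eq.
- apply: (@expressible_connective (fun p q _ => p -> q) _ _ _ _ _ _ _
    leN0N1 ltrho' ltc1' ltc2' IH IH) => *.
  by apply: decidable_imply; exact: decidable_eq.
Qed.

(** The truth value is compared with a given flag instead of being asserted. Negation thus becomes a
    condition on flags, and the induction passes through all connectives. *)
Lemma expressible_fo (q : fo S') N rho c1 c2 :
  N0 <= N -> (forall x, rho x < N) -> c1 < N -> c2 < N ->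
  expressible (fun M e s => (val s c1 = val s c2) <-> fo_sat (pull e s rho) q).
Proof.
elim: q N rho c1 c2 => [a|q IHq|q IHq r IHr|q IHq r IHr|x q IHq|x q IHq] N rho c1 c2
  leN0N ltrho ltc1 ltc2.
- have ltrho' n x : rho x < N + n by have := ltrho x; lia.
  case: a => [t1 t2|r args].
    have E1 := @expressible_term t1 (N + 2) rho (N + 0).
    have E2 := @expressible_term t2 (N + 2) rho (N + 1).
    have [lit _] := decidable_iff (decidable_eq S c1 c2) (decidable_eq S (N + 0) (N + 1)).
    have := expressible_ex_block 2 leN0N (expressible_and
      (expressible_and (E1 _ _ _) (E2 _ _ _)) (expressible_literal lit)).
    move=> /(_ ltac:(lia) (ltrho' 2) ltac:(lia) ltac:(lia) (ltrho' 2) ltac:(lia)).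
    apply: eq_expressible => M e s /=; split.
      move=> [a]; rewrite pull_set_block //
        (@val_set_block_out _ _ _ _ 2 _ _ ltc1)
        (@val_set_block_out _ _ _ _ 2 _ _ ltc2).
      by move=> [[-> ->]].
    move=> H.
    exists (fun y => if y == N + 0 then eval (pull e s rho) t1 else eval (pull e s rho) t2).
    rewrite pull_set_block //
      (@val_set_block_out _ _ _ _ 2 _ _ ltc1)
      (@val_set_block_out _ _ _ _ 2 _ _ ltc2).
    by rewrite !val_set_block_in // !eqn_add2l /=.
  pose n := rar r.
  (* The arguments occupy the first [n] variables from [N] on, the flags of the atom the next
     two. *)
  have Ei i := @expressible_term (args i) (N + (n + 2)) rho (N + i).
  have Eargs : expressible (fun M e s =>
      forall i : 'I_n, val s (N + i) = eval (pull e s rho) (args i)).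
    apply: expressible_forall => i; apply: Ei => //; first lia.
    by rewrite ltn_add2l; exact/ltn_addr/ltn_ord.
  have [lit _] := decidable_iff (decidable_eq S c1 c2) (decidable_eq S (N + n) (N + n.+1)).
  have := expressible_ex_block (n + 2) leN0N (expressible_and
    (expressible_and Eargs (expressible_rel (fun i : 'I_n => N + i) (N + n) (N + n.+1)))
    (expressible_literal lit)).
  apply: eq_expressible => M e s /=.
  rewrite /evals; set u := fun i => eval _ (args i).
  have Eu b : (forall i : 'I_n, val (set_block s N (n + 2) b) (N + i) = u i) ->
      vals (set_block s N (n + 2) b) (fun i : 'I_n => N + i) = u.
    by move=> H; apply: funext => i; exact: H.
  split.
    move=> [b]; rewrite pull_set_block // -/u
      (@val_set_block_out _ _ _ _ (n + 2) _ _ ltc1)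
      (@val_set_block_out _ _ _ _ (n + 2) _ _ ltc2).
    by move=> [[/Eu-> /graph_sound->]].
  (* The flags must be an admissible coding at [u]; for a table there is only one. *)
  move=> H; have [m1 [m2 Q12]] := graph_total e u.
  pose b y := if y < N + n then of_ord N u y else if y == N + n then m1 else m2.
  have Eb : forall i : 'I_n, val (set_block s N (n + 2) b) (N + i) = u i.
    move=> i; have lti : i < n := ltn_ord i; rewrite val_set_block_in; last exact: ltn_addr.
    by rewrite /b ltn_add2l lti of_ordE.
  have Eb1 : val (set_block s N (n + 2) b) (N + n) = m1.
    by rewrite val_set_block_in ?addn2 // /b ltnn eqxx.
  have Eb2 : val (set_block s N (n + 2) b) (N + n.+1) = m2.
    by rewrite val_set_block_in ?addn2 // /b ltn_add2l ltnNge leqnSn eqn_add2l gtn_eqF.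
  exists b; rewrite pull_set_block // -/u (Eu _ Eb) Eb1 Eb2.
  rewrite (@val_set_block_out _ _ _ _ (n + 2) _ _ ltc1).
  rewrite (@val_set_block_out _ _ _ _ (n + 2) _ _ ltc2).
  by rewrite (graph_sound Q12).
- have := @expressible_connective (fun p q _ => p <-> ~ q) N rho c1 c2 q q.
  apply=> // [*|K d1 d2 leNK ? ?|K d1 d2 leNK ? ?]; first last.
  + by apply: (IHq K) => // [|x]; [lia | have := ltrho x; lia].
  + by apply: (IHq K) => // [|x]; [lia | have := ltrho x; lia].
  + exact/decidable_iff/decidable_not/decidable_eq/decidable_eq.
- have := @expressible_connective (fun p q r => p <-> q /\ r) N rho c1 c2 q r.
  apply=> // [*|K d1 d2 leNK ? ?|K d1 d2 leNK ? ?]; first last.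
  + by apply: (IHr K) => // [|x]; [lia | have := ltrho x; lia].
  + by apply: (IHq K) => // [|x]; [lia | have := ltrho x; lia].
  + by apply/decidable_iff/decidable_and; exact: decidable_eq.
- have := @expressible_connective (fun p q r => p <-> q \/ r) N rho c1 c2 q r.
  apply=> // [*|K d1 d2 leNK ? ?|K d1 d2 leNK ? ?]; first last.
  + by apply: (IHr K) => // [|x]; [lia | have := ltrho x; lia].
  + by apply: (IHq K) => // [|x]; [lia | have := ltrho x; lia].
  + by apply/decidable_iff/decidable_or; exact: decidable_eq.
(* Every value satisfying [q] forces the flag to be true, and if the flag is true some value
   satisfies [q]. *)
- have [Eall Eex] := expressible_under_quantifier x IHq leN0N ltrho ltc1 ltc2.
  have := expressible_and (expressible_all_block 1 leN0N Eall)
    (expressible_ex_block 1 leN0N Eex).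
  apply: eq_expressible => M e s /=.
  split=> [[Hall [a]]|[Hex1 Hex2]].
    rewrite pull_quantified // !val_set_block_out // => Hex.
    split=> [/Hex qm|[m qm]]; first by exists (a N).
    by have := Hall (fun=> m); rewrite pull_quantified // !val_set_block_out //; exact.
  split=> [a|].
    by rewrite pull_quantified // !val_set_block_out // => qm; apply: Hex2; exists (a N).
  have [c12|nc12] := pselect (val s c1 = val s c2).
    have [m qm] := Hex1 c12; exists (fun=> m).
    by rewrite pull_quantified.
  (* A false flag makes the implication vacuous, so any value serves. *)
  by exists (fun=> default M); rewrite !val_set_block_out.
- have [Eex Eall] := expressible_under_quantifier x IHq leN0N ltrho ltc1 ltc2.
  have := expressible_and (expressible_all_block 1 leN0N Eall)
    (expressible_ex_block 1 leN0N Eex).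
  apply: eq_expressible => M e s /=.
  split=> [[Hall [a]]|[Hall1 Hall2]].
    rewrite pull_quantified // !val_set_block_out // => Hex.
    split=> [c12 m|qm]; last exact/Hex/qm.
    by have := Hall (fun=> m); rewrite pull_quantified // !val_set_block_out //; exact.
  split=> [a|]; first by rewrite pull_quantified // !val_set_block_out // => /Hall1.
  have [c12|nc12] := pselect (val s c1 = val s c2).
    by exists (fun=> default M); rewrite !val_set_block_out.
  (* With a false flag, a counterexample to the universal formula witnesses the existential half. *)
  have [m qm] : exists m : M, ~ fo_sat (update (pull e s rho) x (m : env_model e)) q.
    by apply/existsNP => /Hall2.
  by exists (fun=> m); rewrite pull_quantified // => /qm.
Qed.

End Expressible.

(** * Coding second order variables by teams *)

Section Tables.
Variable S : signature.

Definition cat_fun T n m (x : 'I_n -> T) (y : 'I_m -> T) : 'I_(n + m) -> T :=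
  fun i => match split i with inl j => x j | inr k => y k end.

Lemma cat_fun_inj T n m (x x' : 'I_n -> T) (y y' : 'I_m -> T) :
  cat_fun x y = cat_fun x' y' <-> x = x' /\ y = y'.
Proof.
split=> [E|[-> ->] //]; split; apply: funext => i.
  by have := congr1 (fun g => g (lshift m i)) E; rewrite /cat_fun (unsplitK (inl i)).
by have := congr1 (fun g => g (rshift n i)) E; rewrite /cat_fun (unsplitK (inr i)).
Qed.

Definition Vars n (x : 'I_n -> var) : 'I_n -> term S := fun i => Var (x i).

Lemma evals_cat (M : model S) (s : assignment M) n m (x : 'I_n -> var) (y : 'I_m -> var) :
  evals s (cat_fun (Vars x) (Vars y)) = cat_fun (vals s x) (vals s y).
Proof. by apply: funext => i; rewrite /evals /cat_fun; case: split. Qed.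

Definition inclusion n m (x : 'I_n -> var) (y : 'I_m -> var) z w : ie S :=
  IEInc (cat_fun (Vars x) (Vars y)) (cat_fun (Vars z) (Vars w)).

Lemma sat_inclusion (M : model S) (X : set (assignment M)) n m
    (x z : 'I_n -> var) (y w : 'I_m -> var) :
  ie_sat X (inclusion x y z w) <->
  forall s, X s -> exists2 s', X s' & vals s x = vals s' z /\ vals s y = vals s' w.
Proof.
by split=> H s /H[s' Xs' E]; exists s' => //; move: E; rewrite !evals_cat => /cat_fun_inj.
Qed.

(* A violation [z] |-> [y], [y'] with [y <> y'] would yield, for the choice
   [u := y'] at the first assignment, a common value of [zu] and [zy] in the right
   half of the split. *)
Definition dependence n (z : 'I_n -> var) y u : ie S :=
  IEAll u (IEOr (IEPos (Eq (Var u) (Var y)))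
    (IEExc (cat_fun (Vars z) (Vars (fun _ : 'I_1 => u)))
           (cat_fun (Vars z) (Vars (fun _ : 'I_1 => y))))).

Lemma sat_dependence (M : model S) (X : set (assignment M)) n (z : 'I_n -> var) y u :
  (forall i, z i < u) -> y < u ->
  ie_sat X (dependence z y u) <->
  forall s s', X s -> X s' -> vals s z = vals s' z -> val s y = val s' y.
Proof.
move=> ltzu ltyu.
have upd_lt (s : assignment M) m x : x < u -> val (update s u m) x = val s x.
  by rewrite /val /update => /ltn_eqF->.
have upd_u (s : assignment M) m : val (update s u m) u = m.
  by rewrite /val /update eqxx.
have upd_z (s : assignment M) m : vals (update s u m) z = vals s z.
  by apply: funext => i; exact: upd_lt.
split=> [[Y [Z [XYZ Yeq Zexc]]] s s' Xs Xs' zE|H].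
  apply: contrapT => yN.
  (* A copy whose [u] differs from [y] cannot lie in the half where the two are equal. *)
  have inZ (s0 : assignment M) m : X s0 -> val s0 y <> m -> Z (update s0 u m).
    move=> Xs0 ym; have : duplicate X u (update s0 u m) by exists s0, m.
    rewrite XYZ => -[/Yeq|//] /=.
    by rewrite -/(val _ u) -/(val _ y) upd_u upd_lt // => /esym.
  have Zs : Z (update s u (val s' y)) by exact: inZ.
  have Zs' : Z (update s' u (val s y)) by apply: inZ => // /esym.
  apply: (Zexc _ _ Zs Zs'); rewrite !evals_cat; apply/cat_fun_inj.
  by rewrite !upd_z zE; split=> //; apply: funext => i; rewrite /vals upd_u upd_lt.
(* A clash inside the right half would, by the dependence of [y] on [z], make [u] equal to [y] in
   the same row. *)
exists [set s | duplicate X u s /\ val s u = val s y],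
       [set s | duplicate X u s /\ val s u <> val s y]; split.
- apply/seteqP; split=> s; last by case=> -[].
  by move=> Xs; have [?|?] := pselect (val s u = val s y); [left | right].
- by move=> s [].
- move=> s s' [[s0 [m [Xs0 ->]]] uy] [[s1 [m' [Xs1 ->]]] _].
  rewrite !evals_cat => /cat_fun_inj[]; rewrite !upd_z => zE.
  move=> /(congr1 (fun g => g ord0)); rewrite /vals [RHS]upd_lt // => uE.
  by apply: uy; rewrite uE upd_lt //; apply/esym/H.
Qed.

(* The rows [(z, w)] of the table, [z] universal and [w] functionally dependent on
   [z], form the graph of a total function. *)
Definition table N n m (p : ie S) : ie S :=
  all_block N n (ex_block (N + n) m (IEAnd
    (bigand (fun j : 'I_m => dependence (fun i : 'I_n => N + i) (N + n + j) (N + n + m)))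
    p)).

Definition table_in N n : 'I_n -> var := fun i => N + i.
Definition table_out N n m : 'I_m -> var := fun j => N + n + j.

(** The first clause makes lookups correct; the second, totality, makes them succeed. *)
Definition is_table (M : model S) N n m (G : ('I_n -> M) -> 'I_m -> M)
    (X : set (assignment M)) :=
  (forall s, X s -> vals s (@table_out N n m) = G (vals s (@table_in N n))) /\
  (forall a, exists2 s, X s & vals s (@table_in N n) = a).

Lemma agree_vals (M : model S) N (s s' : assignment M) n (x : 'I_n -> var) :
  agree N s s' -> (forall i, x i < N) -> vals s x = vals s' x.
Proof. by move=> ss' ltx; apply: funext => i; exact: agree_val (ltx i). Qed.

Lemma is_table_ext (M : model S) N n m (G : ('I_n -> M) -> 'I_m -> M) X Y :
  team_ext (N + n + m) X Y -> is_table N G X -> is_table N G Y.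
Proof.
have ltin (i : 'I_n) : table_in N i < N + n + m.
  by rewrite -addnA ltn_add2l; exact/ltn_addr.
have ltout (j : 'I_m) : @table_out N n m j < N + n + m by rewrite ltn_add2l.
move=> [XY YX] [Xout Xin]; split=> [s /YX[s' Xs' s's]|a].
  by rewrite -(agree_vals s's ltin) -(agree_vals s's ltout); exact: Xout.
have [s /XY[s' Ys' ss'] <-] := Xin a.
by exists s' => //; rewrite (agree_vals ss' ltin).
Qed.

Lemma vals_set_block (M : model S) (s : assignment M) N n a :
  vals (set_block s N n a) (@table_in N n) = fun i : 'I_n => a (N + i).
Proof. by apply: funext => i; rewrite /vals val_set_block_in. Qed.

Lemma table_sat (M : model S) N n m (p : ie S) (X : set (assignment M)) :
  X !=set0 -> ie_sat X (table N n m p) ->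
  exists G Y, [/\ team_ext N X Y, @is_table M N n m G Y & ie_sat Y p].
Proof.
move=> [s0 Xs0] /sat_all_block/sat_ex_block[Y [XY [/sat_bigand Ydep Yp]]].
have {}Ydep s s' : Y s -> Y s' -> vals s (@table_in N n) = vals s' (@table_in N n) ->
    vals s (@table_out N n m) = vals s' (@table_out N n m).
  move=> Ys Ys' zE; apply: funext => j.
  apply: (iffLR (sat_dependence _ _ _) (Ydep j)) => // [i|]; last by rewrite ltn_add2l.
  by rewrite -addnA ltn_add2l; exact/ltn_addr.
(* The universal block overwrites the row [s0], supplied by nonemptiness of [X], with every possible
   input. *)
have Yin a : exists2 s, Y s & vals s (@table_in N n) = a.
  have [b Yb] : exists b, Y (set_block (set_block s0 N n (of_ord N a)) (N + n) m b).
    by apply: XY.1; exists s0, (of_ord N a).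
  eexists; first exact: Yb.
  transitivity (vals (set_block s0 N n (of_ord N a)) (@table_in N n)).
    by apply: funext => i; rewrite /vals val_set_block_out // ltn_add2l.
  by rewrite vals_set_block; apply: funext => i; rewrite of_ordE.
(* The output is read off one chosen row for each input; by dependence all rows with that input
   share it. *)
have /choice[G Gin] (a : 'I_n -> M) : exists g, exists s,
    [/\ Y s, vals s (@table_in N n) = a & vals s (@table_out N n m) = g].
  have [s Ys sa] := Yin a.
  by exists (vals s (@table_out N n m)), s.
exists G, Y; split=> //.
  apply: team_ext_trans (block_team_ext (dup_block_ext N n X)) _.
  exact: team_ext_leq (leq_addr n N) (block_team_ext XY).
split=> // s Ys; have [s' [Ys' zE <-]] := Gin (vals s (@table_in N n)).
by apply: Ydep.
Qed.

Lemma sat_table (M : model S) N n m (p : ie S) (X : set (assignment M))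
    (G : ('I_n -> M) -> 'I_m -> M) :
  X !=set0 ->
  (forall Y, team_ext N X Y -> is_table N G Y -> ie_sat Y p) ->
  ie_sat X (table N n m p).
Proof.
move=> [s0 Xs0] H; apply/sat_all_block/sat_ex_block.
pose b s := of_ord (N + n) (G (vals s (@table_in N n))).
pose Y := [set set_block s (N + n) m (b s) | s in dup_block N n X].
have XY : block_ext (N + n) m (dup_block N n X) Y.
  split=> [s Xs|_ [s Xs <-]]; last by exists s, (b s).
  by exists (b s), s.
have Etable_in s a : vals (set_block s (N + n) m a) (@table_in N n) =
    vals s (@table_in N n).
  by apply: funext => i; rewrite /vals val_set_block_out // ltn_add2l.
have Yout s : Y s -> vals s (@table_out N n m) = G (vals s (@table_in N n)).
  move=> [s' Xs' <-]; rewrite Etable_in; apply: funext => j.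
  by rewrite /vals val_set_block_in // /b of_ordE.
exists Y; split=> //; split.
  apply/sat_bigand => j; apply/sat_dependence => [i||s s' Ys Ys' zE].
  - by rewrite -addnA ltn_add2l; exact/ltn_addr.
  - by rewrite ltn_add2l.
  - rewrite -!/(@table_out N n m j) -!/(vals _ (@table_out N n m) j).
    by rewrite (Yout s) // (Yout s') // zE.
apply: H.
  apply: team_ext_trans (block_team_ext (dup_block_ext N n X)) _.
  exact: team_ext_leq (leq_addr n N) (block_team_ext XY).
split=> // a; pose s := set_block s0 N n (of_ord N a).
exists (set_block s (N + n) m (b s)).
  by exists s => //; exists s0, (of_ord N a).
rewrite Etable_in vals_set_block.
by apply: funext => i; rewrite of_ordE.
Qed.

(** A matched row obeys [G], so the looked-up value is correct. Conversely the tuple at [x] occurs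
    as an input, and the output of that row is forced. *)
Lemma table_inclusion (M : model S) N n m (G : ('I_n -> M) -> 'I_m -> M)
    (X : set (assignment M)) (x : 'I_n -> var) (y : 'I_m -> var) :
  is_table N G X ->
  ie_sat X (inclusion x y (@table_in N n) (@table_out N n m)) <->
  forall s, X s -> vals s y = G (vals s x).
Proof.
move=> [Xout Xin]; rewrite sat_inclusion; split=> H s Xs.
  by have [s' Xs' [-> ->]] := H s Xs; exact: Xout.
have [s' Xs' E] := Xin (vals s x); exists s' => //.
by rewrite H // Xout // E.
Qed.

End Tables.

(** * Adding a tabulated relation or function to the accessible symbols *)

Section SecondOrder.
Variable S : signature.

Definition pair_fun T (c d : T) : 'I_2 -> T := fun j => if j == ord0 then c else d.

Lemma vals_pair (M : model S) (s : assignment M) c d (g : 'I_2 -> M) :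
  vals s (pair_fun c d) = g <-> val s c = g ord0 /\ val s d = g ord_max.
Proof.
split=> [<-|[c0 d1]]; first by [].
by apply: funext => -[[|[|//]] ltj]; rewrite /vals /= ?c0 ?d1; congr g; exact: val_inj.
Qed.

Definition access_rel S' (A : access S S') n N : access S (add_rel S' n) :=
  @Access S (add_rel S' n) (@acc_fun _ _ A)
    (fun o => match o return ('I_(@rar (add_rel S' n) o) -> var) -> var -> var -> ie S with
      | Some r => @acc_rel _ _ A r
      | None => fun x c d =>
          inclusion S x (pair_fun c d) (@table_in N n) (@table_out N n 2)
      end).

Definition flag_rel (M : model S) n (G : ('I_n -> M) -> 'I_2 -> M) : set ('I_n -> M) :=
  [set a | G a ord0 = G a ord_max].

Definition graph_rel S' (M : model S) (e : env S' M) n (G : ('I_n -> M) -> 'I_2 -> M)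
    (o : rsym (add_rel S' n)) : ('I_(rar o) -> M) -> M -> M -> Prop :=
  match o return ('I_(@rar (add_rel S' n) o) -> M) -> M -> M -> Prop with
  | Some r => @graph _ _ _ e r
  | None => fun a m1 m2 => m1 = G a ord0 /\ m2 = G a ord_max
  end.

Lemma graph_rel_total S' (M : model S) (e : env S' M) n G (o : rsym (add_rel S' n)) a :
  exists m1 m2, graph_rel e G (o := o) a m1 m2.
Proof.
case: o a => [r|] a; first exact: graph_total.
by exists (G a ord0), (G a ord_max).
Qed.

Lemma graph_rel_sound S' (M : model S) (e : env S' M) n G (o : rsym (add_rel S' n))
    a m1 m2 :
  graph_rel e G (o := o) a m1 m2 ->
  (m1 = m2) = @rinterp _ (expand_rel (M := env_model e) (flag_rel G)) o a.
Proof. by case: o a => [r|] a /=; [exact: graph_sound | move=> [-> ->]]. Qed.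

Definition env_rel S' (M : model S) (e : env S' M) n (G : ('I_n -> M) -> 'I_2 -> M) :
    env (add_rel S' n) M :=
  @Env S (add_rel S' n) M (@fun_of _ _ _ e)
    (@rinterp _ (expand_rel (M := env_model e) (flag_rel G)))
    _ (graph_rel_total e G) (@graph_rel_sound _ _ e _ G).

(** Earlier lookups survive because [Y] agrees with [X] below [N]; the new table takes the next [n]
    inputs and two flags, whence the new bound. *)
Lemma good_rel S' (A : access S S') N n (M : model S) (e : env S' M)
    (X Y : set (assignment M)) G :
  good A N e X -> team_ext N X Y -> is_table N G Y ->
  good (access_rel A n N) (N + n + 2) (env_rel e G) Y.
Proof.
move=> gX XY tY Z YZ.
have [fZ rZ] : realizes A e Z.
  by apply: gX; apply: team_ext_trans XY (team_ext_leq _ YZ); lia.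
split=> [|[r|] x c d]; [exact: fZ | exact: rZ |].
rewrite (table_inclusion _ _ (is_table_ext YZ tY)).
by split=> H s /H /vals_pair.
Qed.

Definition access_fun S' (A : access S S') n N : access S (add_fun S' n) :=
  @Access S (add_fun S' n)
    (fun o => match o return ('I_(@far (add_fun S' n) o) -> var) -> var -> ie S with
      | Some f => @acc_fun _ _ A f
      | None => fun x c =>
          inclusion S x (fun _ => c) (@table_in N n) (@table_out N n 1)
      end)
    (@acc_rel _ _ A).

Definition env_fun S' (M : model S) (e : env S' M) n (F : ('I_n -> M) -> M) :
    env (add_fun S' n) M :=
  @Env S (add_fun S' n) M (@finterp _ (expand_fun (M := env_model e) F))
    (@rel_of _ _ _ e) (@graph _ _ _ e) (@graph_total _ _ _ e) (@graph_sound _ _ _ e).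

Lemma good_fun S' (A : access S S') N n (M : model S) (e : env S' M)
    (X Y : set (assignment M)) F :
  good A N e X -> team_ext N X Y -> is_table N (fun a (_ : 'I_1) => F a) Y ->
  good (access_fun A n N) (N + n + 1) (env_fun e F) Y.
Proof.
move=> gX XY tY Z YZ.
have [fZ rZ] : realizes A e Z.
  by apply: gX; apply: team_ext_trans XY (team_ext_leq _ YZ); lia.
split=> [[f|] x c|]; [exact: fZ | | exact: rZ].
rewrite (table_inclusion _ _ (is_table_ext YZ tY)).
split=> H s /H; first by move=> /(congr1 (fun g => g ord0)).
by move=> E; apply: funext => j; rewrite /vals -E.
Qed.

Lemma flag_rel_onto (M : model S) n (R : set ('I_n -> M)) : exists G, flag_rel G = R.
Proof.
have /choice[G HG] (a : 'I_n -> M) : exists g : 'I_2 -> M, (g ord0 = g ord_max) = R a.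
  by have [m1 [m2 <-]] := flag_exists M (R a); exists (pair_fun m1 m2).
by exists G; apply: funext.
Qed.

End SecondOrder.

(** * Translation of closed second order formulas *)

Lemma eq_eval S (M : model S) (s s' : assignment M) (t : term S) :
  {in term_fv t, s =1 s'} -> eval s t = eval s' t.
Proof.
elim: t => [x|f args IHargs] /= eqs; first by rewrite eqs ?inE.
congr finterp; apply: funext => i; apply: IHargs => x; rewrite inE => xi.
by apply: eqs; rewrite inE; exists i.
Qed.

(** Coincidence lemma, reconciling assignments obtained by [pull] with the empty assignment in
    [eso_sat]. *)
Lemma eq_fo_sat S (M : model S) (p : fo S) (s s' : assignment M) :
  (forall x, fo_fv p x -> s x = s' x) -> fo_sat s p <-> fo_sat s' p.
Proof.
have eval_eq (u u' : assignment M) (V : set var) t : (forall x, V x -> u x = u' x) ->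
    term_fv t `<=` V -> eval u t = eval u' t.
  by move=> equ tV; apply: eq_eval => x; rewrite inE => /tV /equ.
have upd (u u' : assignment M) (V : set var) x m : (forall y, (V `\ x) y -> u y = u' y) ->
    forall y, V y -> update u x m y = update u' x m y.
  by move=> equ y Vy; rewrite /update; case: eqP => // yx; apply: equ.
elim: p s s' => [[t1 t2|r args]|p IHp|p IHp q IHq|p IHp q IHq|x p IHp|x p IHp] s s' /= eqs.
- by rewrite !(eval_eq s s' _ _ eqs) // => x; [right | left].
- rewrite (_ : evals s args = evals s' args) //; apply: funext => i.
  by apply: eval_eq eqs _ => x xi; exists i.
- by rewrite (IHp s s').
- by rewrite (IHp s s') ?(IHq s s') // => x xp; apply: eqs; [right | left].
- by rewrite (IHp s s') ?(IHq s s') // => x xp; apply: eqs; [right | left].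
- have E m : fo_sat (update s x m) p <-> fo_sat (update s' x m) p.
    by apply: IHp; exact: upd.
  by split=> -[m /E]; exists m.
- have E m : fo_sat (update s x m) p <-> fo_sat (update s' x m) p.
    by apply: IHp; exact: upd.
  by split=> H m; apply/E.
Qed.

(** Each second order quantifier is traded for a table starting at the current bound, and the matrix
    is asserted by requiring its two flags to be equal. Accessible symbols grow along the prefix,
    hence the generality in [A] and [N]. *)
Lemma expressible_eso S S' (P : eso S') (A : access S S') N :
  eso_fv P = set0 ->
  exists p : ie S, forall (M : model S) (e : env S' M) (X : set (assignment M)),
    X !=set0 -> good A N e X -> (ie_sat X p <-> eso_sat P (env_model e)).
Proof.
elim: P A N => {S'} [S' q|S' n P IHP|S' n P IHP] A N /= closed.
- have lt0 (x : var) : (fun=> 0) x < N.+1 by [].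
  have lit : literal (fun (M : model S) (s : assignment M) => val s N.+1 = val s N.+2).
    by case: (decidable_eq S N.+1 N.+2).
  (* The matrix is closed, so a constant [rho] is harmless. *)
  have := expressible_fo A q (N0 := N) (N := N.+3) (rho := fun=> 0) (c1 := N.+1) (c2 := N.+2).
  move=> /(_ ltac:(lia) ltac:(lia) ltac:(lia) ltac:(lia)) Eq.
  have [p Hp] := expressible_ex_block 2 (leqnSn N)
    (expressible_and Eq (expressible_literal A N lit)).
  have Hq (M : model S) (e : env S' M) s : fo_sat (pull e s (fun=> 0)) q <->
      fo_sat (empty_assignment (env_model e)) q.
    by apply: eq_fo_sat => x; rewrite closed.
  exists p => M e X [s0 Xs0] gX; rewrite (Hp _ _ _ gX).
  split=> [H|Hsat s Xs].
    by have [a []] := H s0 Xs0; rewrite Hq => H1 /H1.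
  (* Equal values in both flags code truth. *)
  exists (fun=> default M).
  have E i : i < 2 -> val (set_block s N.+1 2 (fun=> default M)) (N.+1 + i) = default M.
    exact: val_set_block_in.
  have := E 0; have := E 1; rewrite addn0 addn1 => -> // -> //.
  by split=> //; split=> // _; apply/Hq.
- have [p Hp] := IHP (access_rel A n N) (N + n + 2) closed.
  exists (table N n 2 p) => M e X X0 gX; split=> [/table_sat[//|G [Y [XY tY]]]|[R]].
    rewrite (Hp M (env_rel e G)); last exact: good_rel XY tY.
      by exists (flag_rel G).
    exact: team_ext_nonempty XY X0.
  have [G <-] := flag_rel_onto R => PR; apply: (sat_table (G := G)) => // Y XY tY.
  apply/(Hp M (env_rel e G)) => //; last exact: good_rel XY tY.
  exact: team_ext_nonempty XY X0.
- have [p Hp] := IHP (access_fun A n N) (N + n + 1) closed.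
  exists (table N n 1 p) => M e X X0 gX; split=> [/table_sat[//|G [Y [XY tY]]]|[F PF]].
    (* One-element tuples of outputs are identified with elements of [M]. *)
    have tY' : is_table N (fun a (_ : 'I_1) => G a ord0) Y.
      by move: tY; congr is_table; apply: funext => a; apply: funext => j; rewrite [j]ord1.
    rewrite (Hp M (env_fun e (fun a => G a ord0))); last exact: good_fun XY tY'.
      by exists (fun a => G a ord0).
    exact: team_ext_nonempty XY X0.
  apply: (sat_table (G := fun a _ => F a)) => // Y XY tY.
  apply/(Hp M (env_fun e F)) => //; last exact: good_fun XY tY.
  exact: team_ext_nonempty XY X0.
Qed.

(** * Access to the symbols of the original signature *)

Section Base.
Variable S : signature.

Lemma rel_flag_literal (r : rsym S) (x : 'I_(rar r) -> var) c d :
  literal (fun (M : model S) (s : assignment M) =>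
    (val s c = val s d) <-> rinterp (vals s x)).
Proof.
by case: (decidable_iff (decidable_eq S c d) (decidable_atom (@Rel S r (Vars S x)))).
Qed.

(** Flat formulas look up the symbols of [S] in any team, without a table. *)
Definition access_id : access S S :=
  @Access S S (fun f x c => IEPos (Eq (App (Vars S x)) (Var c)))
    (fun r x c d => sval (cid (@rel_flag_literal r x c d))).

Lemma rel_flag_total (M : model S) (r : rsym S) (a : 'I_(rar r) -> M) :
  exists m1 m2 : M, (m1 = m2) <-> rinterp a.
Proof. by have [m1 [m2 E]] := flag_exists M (rinterp a); exists m1, m2; rewrite E. Qed.

Lemma rel_flag_sound (M : model S) (r : rsym S) (a : 'I_(rar r) -> M)
    (m1 m2 : M) :
  ((m1 = m2) <-> rinterp a) -> (m1 = m2) = rinterp a.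
Proof. exact: propext. Qed.

Definition env_id (M : model S) : env S M :=
  @Env S S M (@finterp S M) (@rinterp S M) _ (@rel_flag_total M) (@rel_flag_sound M).

Lemma good_id N (M : model S) (X : set (assignment M)) : good access_id N (env_id M) X.
Proof.
move=> Y _; split=> // r x c d /=.
by case: cid => p /= /(_ M Y).
Qed.

End Base.

(** * Tying the tabulated relation to the team *)

Lemma range_sub_table S N k (v : 'I_k -> var) :
  (forall i, v i < N) ->
  exists p : ie S, forall (M : model S) (X : set (assignment M)) G,
    is_table N G X ->
    (ie_sat X p <-> [set vals s v | s in X] `<=` flag_rel G).
Proof.
move=> ltv; pose K := N + k + 2.
(* Taking the single variable [K] for both flags forces the pair looked up at [v] to be a coding of
   truth. *)
have [p Hp] := expressible_ex_block 1 (leqnn K)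
  (@expressible_rel _ _ (access_rel (access_id S) k N) K None v K K).
exists p => M X G tX.
have gX := good_rel (@good_id _ N _ X) (team_ext_refl N X) tX.
have valK (s : assignment M) a : vals (set_block s K 1 a) v = vals s v.
  by apply: funext => i; apply: val_set_block_out; rewrite /K -addnA; exact/ltn_addr.
rewrite (Hp M _ X gX) /=; split.
  by move=> H _ [s Xs <-]; have [a] := H s Xs; rewrite valK => -[E0 E1];
    rewrite /flag_rel /= -E0.
move=> sub s Xs; have /sub Gv : [set vals s v | s in X] (vals s v) by exists s.
exists (fun=> G (vals s v) ord0); rewrite valK.
by rewrite -[X in val _ X]addn0 val_set_block_in.
Qed.

(** Each row guesses a tuple among the values of [v], and this tuple must be the table input of the
    row whenever the flags there agree. Since all inputs occur, the whole coded relation is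
    covered. *)
Lemma table_sub_range S N k (v : 'I_k -> var) :
  (forall i, v i < N) ->
  exists p : ie S, forall (M : model S) (X : set (assignment M)) G,
    X !=set0 -> is_table N G X ->
    (ie_sat X p <-> flag_rel G `<=` [set vals s v | s in X]).
Proof.
move=> ltv; pose K := N + k + 2; pose out := @table_out N k 2.
have [_ lit0] := decidable_eq S (out ord0) (out ord_max).
have lit1 : literal (fun (M : model S) (s : assignment M) =>
    vals s (@table_in K k) = vals s (@table_in N k)).
  exists (bigand (fun i : 'I_k => IEPos (Eq (Var (table_in K i)) (Var (table_in N i))))).
  move=> M X; rewrite sat_bigand; split=> [H s Xs|H i s Xs].
    by apply: funext => i; exact: H.
  exact: (congr1 (fun g => g i) (H s Xs)).
have [q Hq] := literal_or lit0 lit1.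
exists (ex_block K k (IEAnd q (IEInc (Vars S (@table_in K k)) (Vars S v)))).
move=> M X G [s0 Xs0] [Xout Xin]; rewrite sat_ex_block.
have valK (s : assignment M) a n (x : 'I_n -> var) : (forall i, x i < K) ->
    vals (set_block s K k a) x = vals s x.
  by move=> ltx; apply: funext => i; exact: val_set_block_out.
have ltvK i : v i < K by rewrite /K -addnA; exact/ltn_addr.
have ltin (i : 'I_k) : table_in N i < K.
  by rewrite /K -addnA ltn_add2l; exact/ltn_addr.
have ltout j : out j < K by rewrite ltn_add2l.
split=> [[Y [[XY YX] [/Hq Yq Yinc]]] a Ga|sub].
  have [s Xs sa] := Xin a; have [b Yb] := XY s Xs.
  have [] := Yq _ Yb.
    rewrite -!/(vals _ out _) valK // Xout // sa; exact: absurd.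
  rewrite vals_set_block valK // sa => ua.
  have [s' /YX[s1 [b1 [Xs1 ->]]] E] := Yinc _ Yb.
  by exists s1 => //; rewrite -(valK s1 b1) // -ua -(vals_set_block s); exact/esym.
have /choice[u Hu] (s : assignment M) : exists w, (exists2 s', X s' & vals s' v = w) /\
    (flag_rel G (vals s (@table_in N k)) -> w = vals s (@table_in N k)).
  have [Gs|nGs] := pselect (flag_rel G (vals s (@table_in N k))).
    by exists (vals s (@table_in N k)); split=> //; exact: sub.
  (* The dummy tuple for inputs outside the relation. *)
  by exists (vals s0 v); split=> //; exists s0.
pose Y := [set set_block s K k (of_ord K (u s)) | s in X].
exists Y; split.
  split=> [s Xs|_ [s Xs <-]]; last by exists s, (of_ord K (u s)).
  by exists (of_ord K (u s)), s.
have Eu s : vals (set_block s K k (of_ord K (u s))) (@table_in K k) = u s.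
  by rewrite vals_set_block; apply: funext => i; rewrite of_ordE.
split.
  apply/Hq => _ [s Xs <-]; rewrite -!/(vals _ out _) Eu !valK // Xout //.
  have [Gs|nGs] := pselect (flag_rel G (vals s (@table_in N k))); last by left.
  by right; exact: (Hu s).2.
move=> _ [s Xs <-]; have [[s' Xs' s'u] _] := Hu s.
(* The new block lies above [v], so the extension of [s'] still has the required values at [v]. *)
exists (set_block s' K k (of_ord K (u s'))); first by exists s'.
by rewrite -[LHS]/(vals _ _) Eu -[RHS]/(vals _ _) valK.
Qed.

Lemma ie_fv_bounded S (p : ie S) : exists N, forall x, ie_fv p x -> x < N.
Proof.
have maxn_bound n (V : 'I_n -> set var) : (forall i, exists N, forall x, V i x -> x < N) ->
    exists N, forall x, (exists i, V i x) -> x < N.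
  move=> /choice[N HN]; exists (\max_i N i) => x [i /HN]/leq_trans; apply.
  exact: leq_bigmax.
have U_bound (V W : set var) : (exists N, forall x, V x -> x < N) ->
    (exists N, forall x, W x -> x < N) -> exists N, forall x, (V `|` W) x -> x < N.
  move=> [N HN] [K HK]; exists (N + K) => x [/HN|/HK]; lia.
have term_bound (t : term S) : exists N, forall x, term_fv t x -> x < N.
  by elim: t => [x|f args IH]; [exists x.+1 => _ -> | exact: maxn_bound].
have atom_bound (a : atom S) : exists N, forall x, atom_fv a x -> x < N.
  by case: a => [t1 t2|r args]; [exact: U_bound | exact: maxn_bound].
have tuple_bound n (t1 t2 : 'I_n -> term S) :
    exists N, forall x, (exists i, term_fv (t1 i) x \/ term_fv (t2 i) x) -> x < N.
  by apply: maxn_bound => i; exact: U_bound.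
elim: p => //= [p IHp q IHq|p IHp q IHq|x p [N HN]|x p [N HN]].
- exact: U_bound.
- exact: U_bound.
- by exists N => y [/HN].
- by exists N => y [/HN].
Qed.

(* Existentially quantifying variables outside [v] does not affect the condition
   on the right, so it serves to close [p]. *)
Lemma close_formula S k (v : 'I_k -> var) (p : ie S)
    (B : forall M : model S, set ('I_k -> M) -> Prop) :
  (forall (M : model S) (X : set (assignment M)), X !=set0 ->
    (ie_sat X p <-> B M [set vals s v | s in X])) ->
  exists q : ie S, ie_fv q `<=` range v /\
    (forall (M : model S) (X : set (assignment M)), X !=set0 ->
      (ie_sat X q <-> B M [set vals s v | s in X])).
Proof.
have [N HN] := ie_fv_bounded p; have {HN} : ie_fv p `<=` range v `|` [set x | x < N].
  by move=> x /HN; right.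
(* The free variables lie in [v] or below [N]; each step lowers the bound, quantifying the top
   variable unless it belongs to [v]. *)
elim: N p => [|N IHN] p fvp Hp.
  by exists p; split=> // x /fvp[].
have [vN|nvN] := pselect (range v N).
  apply: IHN Hp => x /fvp[vx|]; first by left.
  by rewrite /= ltnS leq_eqVlt => /orP[/eqP->|]; [left | right].
apply: (IHN (IEEx N p)) => [x [/fvp[vx|ltx] xN]|M X X0 /=]; first by left.
  right; move: ltx; rewrite /= ltnS leq_eqVlt => /orP[/eqP|//].
  by move/xN.
have sup H : (forall s, X s -> H s !=set0) ->
    ie_sat (supplement X N H) p <-> B M [set vals s v | s in X].
  move=> H0; have upd (s : assignment M) m : vals (update s N m) v = vals s v.
    apply: funext => i; rewrite /vals /val /update; case: eqP => // vN.
    by case: nvN; exists i.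
  rewrite Hp; last first.
    by have [s Xs] := X0; have [m Hm] := H0 s Xs; exists (update s N m), s, m.
  suff -> : [set vals s v | s in supplement X N H] = [set vals s v | s in X] by [].
  apply/seteqP; split=> [_ [_ [s [m [Xs _ ->]]] <-]|_ [s Xs <-]].
    by rewrite upd; exists s.
  have [m Hm] := H0 s Xs; exists (update s N m) => //.
  by exists s, m.
(* By [sup] any choice of nonempty sets works; the full domain is taken. *)
split=> [[H [H0 /(sup H H0)//]]|BX]; exists (fun _ => setT).
have H0 s : X s -> (setT : set M) !=set0 by exists (default M).
by split=> //; apply/sup.
Qed.

Theorem theorem6p2 (S : signature) (k : nat) (Phi : eso (add_rel S k))
    (Phi_closed : eso_fv Phi = set0) (v : 'I_k -> var) (v_inj : injective v) :
  exists phi : ie S,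
    ie_fv phi `<=` range v /\
    forall (M : model S) (V : set var) (X : set (assignment M)),
      is_team V X -> X !=set0 -> range v `<=` V ->
      (ie_sat X phi <-> eso_sat Phi (expand_rel (team_rel v X))).
Proof.
(* The table for [A] starts above every variable of [v], so its quantifiers do not change the values
   of [v]. *)
pose N := (\max_i v i).+1.
have ltv i : v i < N by rewrite ltnS; exact: leq_bigmax.
have [p1 H1] := range_sub_table S ltv.
have [p2 H2] := table_sub_range S ltv.
have [p3 H3] := expressible_eso (access_rel (access_id S) k N) (N + k + 2) Phi_closed.
have [|phi [fv_phi Hphi]] := @close_formula S k v (table N k 2 (IEAnd (IEAnd p1 p2) p3))
    (fun M R => eso_sat Phi (expand_rel R)).
  move=> M X X0.
  have imY Y : team_ext N X Y -> [set vals s v | s in Y] = [set vals s v | s in X].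
    move=> [XY YX]; apply/seteqP; split=> r [s].
      by move=> /YX[s' Xs' s's] <-; exists s' => //; exact: agree_vals s's ltv.
    by move=> /XY[s' Ys' ss'] <-; exists s' => //; exact/esym/(agree_vals ss' ltv).
  split=> [/table_sat[//|G [Y [XY tY /= [[Y1 Y2] Y3]]]]|sat].
    have Y0 := team_ext_nonempty XY X0.
    have gY := good_rel (@good_id _ N _ X) XY tY.
    have -> : [set vals s v | s in X] = flag_rel G.
      rewrite -(imY Y XY); apply/seteqP.
      by split; [apply: (iffLR (H1 M Y G tY)) | apply: (iffLR (H2 M Y G Y0 tY))].
    exact: (iffLR (H3 M (env_rel (env_id M) G) Y Y0 gY)).
  have [G EG] := flag_rel_onto [set vals s v | s in X].
  apply: (sat_table (G := G)) => // Y XY tY /=.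
  have Y0 := team_ext_nonempty XY X0.
  have gY := good_rel (@good_id _ N _ X) XY tY.
  split; last first.
    by apply: (iffRL (H3 M (env_rel (env_id M) G) Y Y0 gY)); rewrite /env_model /= EG.
  split; [apply: (iffRL (H1 M Y G tY)) | apply: (iffRL (H2 M Y G Y0 tY))];
    by rewrite EG imY.
exists phi; split=> // M V X teamX X0 vV; rewrite Hphi //.
(* The domain of the team contains [v], so [val] never falls back on the default there. *)
suff -> : team_rel v X = [set vals s v | s in X] by [].
apply/seteqP; split=> [r [s Xs sr]|_ [s Xs <-]]; exists s => //.
  by apply: funext => i; rewrite /vals /val sr.
move=> i; have : adom s (v i) by rewrite (teamX s Xs); apply: vV; exists i.
by rewrite /adom /vals /val /=; case: (s (v i)).
Qed.
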